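(* Let $\mathcal{M}$ be a von Neumann algebra with no central summands of type $\mathrm{I}_1$. If $\Phi:\mathcal{M}\rightarrow\mathcal{M}$ is a nonlinear derivation, i.e. a map (not assumed additive or linear) satisfying $\Phi(TS)=\Phi(T)S+T\Phi(S)$ for all $T,S\in\mathcal{M}$, then $\Phi$ is an additive derivation; that is, in addition $\Phi(T+S)=\Phi(T)+\Phi(S)$ for all $T,S\in\mathcal{M}$.
   Context: A von Neumann algebra $\mathcal{M}$ is a weakly closed, self-adjoint algebra of bounded operators on a complex Hilbert space $H$ containing the identity operator $I$. ''No central summands of type $\mathrm{I}_1$'' means that there is no nonzero central projection $Q\in\mathcal{M}$ such that $Q\mathcal{M}$ is commutative. A nonlinear derivation is a map $\Phi:\mathcal{M}\to\mathcal{M}$, with no additivity, linearity or continuity assumed, satisfying the derivation identity for products. An additive derivation is an additive map $\delta:\mathcal{M}\to\mathcal{M}$ with $\delta(xy)=\delta(x)y+x\delta(y)$ for all $x,y\in\mathcal{M}$. *)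

(* Defs.v *)
From HB Require Import structures.
From mathcomp Require Import all_boot all_order all_algebra.
From mathcomp Require Import complex.
From mathcomp Require Import all_classical all_reals all_analysis.

Set Implicit Arguments.
Unset Strict Implicit.
Unset Printing Implicit Defensive.

Import Order.TTheory GRing.Theory Num.Theory.

Local Open Scope classical_set_scope.
Local Open Scope ring_scope.
Local Open Scope complex_scope.

(* A complex Hilbert space is a complete normed space over R[i] whose norm is
   induced by an inner product; the latter is linear in its first argument. *)
Definition induces_norm (R : realType) (H : completeNormedModType R[i])
    (dot : {dot H for Num.conj}) : Prop :=
  forall x : H, `|x| ^+ 2 = dot x x.

Section Operators.
Variables (R : realType) (H : completeNormedModType R[i]).
Variable dot : {dot H for Num.conj}.
Implicit Types (T S Q : H -> H) (M : set (H -> H)).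

Definition bounded_operator T : Prop :=
  linear T /\ exists c : R, forall x : H, `|T x| <= c%:C * `|x|.

Definition adjoint_of T T' : Prop :=
  forall x y : H, dot (T x) y = dot x (T' y).

(* The sets {S | |<(T - S)x, y>| < e for all (x, y) in s}, with s finite and
   e > 0, form a base of neighbourhoods of T for the weak operator topology. *)
Definition wot_closure M : set (H -> H) :=
  [set T | bounded_operator T /\
    forall (s : seq (H * H)) (e : R), 0 < e ->
      exists2 S, M S &
        forall p : H * H, p \in s -> `|dot (T p.1 - S p.1) p.2| < e%:C].

Record von_neumann_algebra M : Prop := {
  vna_bounded : M `<=` bounded_operator;
  vna_id : M idfun;
  vna_add : forall T S, M T -> M S -> M (T + S);
  vna_scale : forall (a : R[i]) T, M T -> M (a *: T);
  vna_comp : forall T S, M T -> M S -> M (T \o S);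
  vna_adjoint : forall T, M T -> exists2 T', M T' & adjoint_of T T';
  vna_closed : wot_closure M `<=` M
}.

Definition projection Q : Prop := Q \o Q = Q /\ adjoint_of Q Q.

Definition central_projection M Q : Prop :=
  [/\ M Q, projection Q & forall T, M T -> Q \o T = T \o Q].

Definition commutative_set M : Prop :=
  forall T S, M T -> M S -> T \o S = S \o T.

Definition no_central_summand_I1 M : Prop :=
  ~ exists Q, [/\ central_projection M Q, Q <> 0 &
                  commutative_set [set Q \o T | T in M]].

Definition nonlinear_derivation M (Phi : {fun M >-> M}) : Prop :=
  forall T S, M T -> M S -> Phi (T \o S) = (Phi T \o S) + (T \o Phi S).

Definition additive_derivation M (delta : {fun M >-> M}) : Prop :=
  (forall T S, M T -> M S -> delta (T + S) = delta T + delta S) /\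
  (forall T S, M T -> M S -> delta (T \o S) = (delta T \o S) + (T \o delta S)).

End Operators.

(* Main.v *)
From HB Require Import structures.
Require Import Defs.
From mathcomp Require Import all_boot all_order all_algebra.
From mathcomp Require Import complex.
From mathcomp Require Import all_classical all_reals all_analysis.
From mathcomp Require Import lra.

Set Implicit Arguments.
Unset Strict Implicit.
Unset Printing Implicit Defensive.

Import Order.TTheory GRing.Theory Num.Theory.
Import numFieldNormedType.Exports.

Local Open Scope classical_set_scope.
Local Open Scope ring_scope.
Local Open Scope complex_scope.

(** Let [D(T, S) = Phi(T + S) - Phi(T) - Phi(S)] be the defect of additivity.
    The derivation identity makes the terms in [Phi(A)] cancel, so that
    [A D(T, S) = D(A T, A S)] and [D(T, S) A = D(T A, S A)] (lemmas [defectMl]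
    and [defectMr]).  Two facts force [D] to vanish.

    - Algebra.  For an idempotent [e] with complement [f = 1 - e], the corner
      [e D(T, S) f] is the defect of the two elements [e T f] and [e S f], and
      it is zero because [u + v = (e + u) (v + f)] for [u], [v] in [e A f].
      Exchanging [e] and [f] shows that [D(T, S)] commutes with [e]
      ([defect_comm_idempotent]).

    - Analysis.  An element of a von Neumann algebra [M] that commutes with the
      projections of [M] is central in [M] ([commute_of_projections]).

    Hence all values of [D] are central.  As [B D(T, S) = D(B T, B S)] is again
    a value of [D], moving central factors around gives
    [A B D(T, S) = B A D(T, S)] for all [A], [B].  Let [E] be the projection on
    the kernel of [D(T, S)].  It lies in [M] and is central, and [1 - E]
    annihilates all commutators: [(1 - E) M] is commutative.  Without central
    summands of type I_1 this means [E = 1], that is [D(T, S) = 0]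
    ([no_I1_central_eq0]).

    The analytic fact is obtained from explicit limits rather than from the
    spectral theorem.  For a selfadjoint contraction [A] put [G = 1 - A^2].

    - The even powers of [G] converge strongly to the projection on the kernel
      of [A], which therefore belongs to [M] ([kernel_projection]).

    - The iteration [Y -> (G + Y^2) / 2] converges in norm, and [S = 1 - Y] is a
      square root of [1 - G = A^2], an avatar of the absolute value of [A]
      ([sqrt_one_sub]).

    - If [E] is the projection on the kernel of [S - A], then [2 E - 1] is a sign
      of [A], that is [A = S (2 E - 1)].  Both [S] and [S - 1] are contractions,
      so that [A - (2 E - 1) / 2 = (S - 1 / 2) (2 E - 1)] has norm at most
      [sqrt 3 / 2] ([projection_halving]).

    Subtracting [E - 1 / 2] does not change the commutator of [A] with an
    operator commuting with [E]; rescaling and iterating shows that this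
    commutator is arbitrarily small. *)

(** * The additivity defect of a multiplicative derivation *)
Section MultiplicativeDerivation.
Variables (A : pzRingType) (phi : A -> A).
Hypothesis phiM : forall x y, phi (x * y) = phi x * y + x * phi y.

Definition defect x y := phi (x + y) - phi x - phi y.

Lemma mul_derivation0 : phi 0 = 0.
Proof. by have := phiM 0 0; rewrite mul0r mulr0 mul0r addr0. Qed.

Lemma defect0r x : defect x 0 = 0.
Proof. by rewrite /defect addr0 mul_derivation0 subr0 subrr. Qed.

Lemma defect0l x : defect 0 x = 0.
Proof. by rewrite /defect add0r mul_derivation0 subr0 subrr. Qed.

Lemma defect_eq0 x y : defect x y = 0 -> phi (x + y) = phi x + phi y.
Proof. by rewrite /defect -addrA -opprD => /subr0_eq. Qed.

Let cancel_cross (p q r s t : A) : p + q + r - (p + s) - (q + t) = r - s - t.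
Proof.
rewrite -[LHS]addrA -opprD addrACA opprD addrA [p + q + r]addrC addrK.
by rewrite opprD addrA.
Qed.

Lemma defectMl a x y : a * defect x y = defect (a * x) (a * y).
Proof.
by rewrite /defect -mulrDr !phiM !mulrBr [phi a * _]mulrDr cancel_cross.
Qed.

Lemma defectMr a x y : defect x y * a = defect (x * a) (y * a).
Proof.
rewrite /defect -mulrDl !phiM !mulrBl.
by rewrite ![phi _ * a + _ * phi a]addrC [_ * phi a]mulrDl cancel_cross.
Qed.

Section Idempotent.
Variables e f : A.
Hypotheses (ee : e * e = e) (eDf : e + f = 1).

Let fE : f = 1 - e. Proof. by rewrite -eDf addrC addKr. Qed.
Let ef : e * f = 0. Proof. by rewrite fE mulrBr mulr1 ee subrr. Qed.
Let fe : f * e = 0. Proof. by rewrite fE mulrBl mul1r ee subrr. Qed.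
Let ff : f * f = f. Proof. by rewrite {1}fE mulrBl mul1r ef subr0. Qed.

(** [e D(e x, f y)] and [f D(e x, f y)] are defects with a zero argument. *)
Lemma defect_rows x y : defect (e * x) (f * y) = 0.
Proof.
rewrite -[LHS]mul1r -eDf mulrDl !defectMl.
by rewrite !mulrA fe ff ee ef !mul0r defect0r defect0l addr0.
Qed.

Lemma defect_cols x y : defect (x * e) (y * f) = 0.
Proof.
rewrite -[LHS]mulr1 -eDf mulrDr !defectMr.
by rewrite -!mulrA fe ff ee ef !mulr0 defect0r defect0l add0r.
Qed.

(** For [u], [v] in the corner [e A f] one has [u v = 0] and
    [u + v = (e + u) (v + f)].  On each of the two factors [phi] is additive, by
    [defect_cols] and [defect_rows]; expanding [phi] of the product then gives
    [phi u + phi v]. *)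
Lemma defect_corner x y : defect (e * x * f) (e * y * f) = 0.
Proof.
set u := e * x * f; set v := e * y * f.
have ev : e * v = v by rewrite !mulrA ee.
have uf : u * f = u by rewrite -mulrA ff.
have uv : u * v = 0 by rewrite /v !mulrA -[u * e]mulrA fe mulr0 !mul0r.
have eDu : phi (e + u) = phi e + phi u.
  by apply: defect_eq0; have := defect_cols e u; rewrite ee uf.
have fDv : phi (v + f) = phi v + phi f.
  by apply: defect_eq0; have := defect_rows v f; rewrite ev ff.
have uvE : (e + u) * (v + f) = u + v.
  by rewrite mulrDl !mulrDr ev ef uv uf addr0 add0r addrC.
rewrite /defect -uvE phiM eDu fDv 2!mulrDr addrACA !mulrDl.
rewrite [phi e * v + _ + _]addrACA [phi e * f + _ + _]addrACA -!phiM.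
by rewrite ev uf uv ef mul_derivation0 addr0 add0r addrK subrr.
Qed.

Lemma defect_offdiag x y : e * defect x y * f = 0.
Proof. by rewrite defectMl defectMr defect_corner. Qed.

End Idempotent.

Lemma defect_comm_idempotent e x y : e * e = e ->
  e * defect x y = defect x y * e.
Proof.
move=> ee; set d := defect x y.
have ff : (1 - e) * (1 - e) = 1 - e.
  by rewrite mulrBl mul1r mulrBr mulr1 ee subrr subr0.
have eDf : e + (1 - e) = 1 by rewrite addrC subrK.
have edf := defect_offdiag ee eDf x y.
have fde := defect_offdiag ff (subrK e 1) x y.
rewrite -[LHS]mulr1 -eDf mulrDr edf addr0.
by rewrite -[RHS]mul1r -eDf mulrDl !mulrA fde addr0.
Qed.

End MultiplicativeDerivation.

(** * The underlying real Hilbert space *)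

(** The norm and the inner product of [H] take their values in [R[i]], whose
    order is only partial.  The estimates are made with the real norm and the
    real part of the inner product, which determine the complex ones: see
    [nrmE] and [rdot_adjoint]. *)
Section Hilbert.
Variables (R : realType) (H : completeNormedModType R[i]).
Variables (dot : {dot H for Num.conj}).
Hypothesis dot_norm : induces_norm dot.

Definition nrm (x : H) : R := complex.Re `|x|.
Definition rdot (x y : H) : R := complex.Re (dot x y).

Lemma nrmE x : `|x| = (nrm x)%:C.
Proof. by rewrite RRe_real // normr_real. Qed.

Lemma nrm_ge0 x : 0 <= nrm x.
Proof. by rewrite -lecR -nrmE normr_ge0. Qed.

Lemma nrmD x y : nrm (x + y) <= nrm x + nrm y.
Proof. by rewrite -lecR rmorphD /= -!nrmE ler_normD. Qed.

Lemma nrmN x : nrm (- x) = nrm x.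
Proof. by rewrite /nrm normrN. Qed.

Lemma nrmZ (a : R) x : nrm (a%:C *: x) = `|a| * nrm x.
Proof.
apply: complexI; rewrite -nrmE normrZ nrmE rmorphM; congr (_ * _).
by rewrite normc_def /= expr0n addr0 sqrtr_sqr.
Qed.

Lemma nrm_eq0 x : nrm x = 0 -> x = 0.
Proof. by move=> x0; apply/normr0_eq0; rewrite nrmE x0. Qed.

Lemma nrm0 : nrm 0 = 0.
Proof. by rewrite /nrm normr0. Qed.

Lemma nrm_sqr x : nrm x ^+ 2 = rdot x x.
Proof.
apply: complexI; rewrite rmorphXn /= -nrmE dot_norm /rdot RRe_real //.
by rewrite -dot_norm rpredX // normr_real.
Qed.

Lemma rdotC x y : rdot x y = rdot y x.
Proof.
apply: complexI; rewrite !complexRe hermC expr0 mul1r; exact: Re_conj.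
Qed.

Lemma rdotDl x y z : rdot (x + y) z = rdot x z + rdot y z.
Proof. by rewrite /rdot linearDl raddfD. Qed.

Lemma rdotNl x z : rdot (- x) z = - rdot x z.
Proof. by rewrite /rdot linearNl raddfN. Qed.

Lemma rdotDr x y z : rdot z (x + y) = rdot z x + rdot z y.
Proof. by rewrite !(rdotC z) rdotDl. Qed.

Lemma rdotNr x z : rdot z (- x) = - rdot z x.
Proof. by rewrite !(rdotC z) rdotNl. Qed.

Lemma rdotZl (a : R) x z : rdot (a%:C *: x) z = a * rdot x z.
Proof.
by rewrite /rdot linearZl_LR /=; case: (dot x z) => p q /=; rewrite mul0r subr0.
Qed.

Lemma rdotZr (a : R) x z : rdot z (a%:C *: x) = a * rdot z x.
Proof. by rewrite !(rdotC z) rdotZl. Qed.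

Lemma rdot0r x : rdot x 0 = 0.
Proof. by rewrite /rdot linear0r. Qed.

Lemma nrmB_sqr x y : nrm (x - y) ^+ 2 = nrm x ^+ 2 - 2 * rdot x y + nrm y ^+ 2.
Proof.
rewrite !nrm_sqr rdotDl !rdotDr !rdotNl !rdotNr (rdotC y x); lra.
Qed.

(** Cauchy-Schwarz, from the square of the norm of [|y| x - |x| y]. *)
Lemma rdot_le x y : rdot x y <= nrm x * nrm y.
Proof.
have [x0|x0] := eqVneq (nrm x) 0.
  by rewrite x0 mul0r (nrm_eq0 x0) /rdot linear0l.
have [y0|y0] := eqVneq (nrm y) 0.
  by rewrite y0 mulr0 (nrm_eq0 y0) /rdot linear0r.
have p : 0 < nrm x * nrm y by rewrite mulr_gt0 // lt0r ?x0 ?y0 nrm_ge0.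
have := sqr_ge0 (nrm ((nrm y)%:C *: x - (nrm x)%:C *: y)).
rewrite nrmB_sqr rdotZl rdotZr !nrmZ !ger0_norm ?nrm_ge0 // => h.
by rewrite -(ler_pM2l p); nra.
Qed.

Lemma rdot_ext x y : (forall z, rdot x z = rdot y z) -> x = y.
Proof.
move=> xy; apply/eqP; rewrite -subr_eq0; apply/eqP/nrm_eq0/eqP.
by rewrite -sqrf_eq0 nrm_sqr rdotDl rdotNl xy subrr.
Qed.

Lemma dotZl (a : R[i]) x y : dot (a *: x) y = a * dot x y.
Proof. exact: linearZl_LR. Qed.

(** The complex inequality follows from the real one for [c^* x] and [y], where
    [c = dot x y]: the inner product of these two vectors is [|c|^2]. *)
Lemma dot_le x y : `|dot x y| <= (nrm x * nrm y)%:C.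
Proof.
set c := dot x y; have [->|c0] := eqVneq c 0.
  by rewrite normr0 ler0c mulr_ge0 ?nrm_ge0.
have cp : 0 < `|c| by rewrite normr_gt0.
rewrite -(ler_pM2l cp).
have E : dot (Num.conj c *: x) y = `|c| * `|c|.
  by rewrite dotZl -normCKC expr2.
have -> : `|c| * `|c| = (rdot (Num.conj c *: x) y)%:C.
  by rewrite /rdot E RRe_real // rpredM // normr_real.
have -> : `|c| * (nrm x * nrm y)%:C = (nrm (Num.conj c *: x) * nrm y)%:C.
  by rewrite !rmorphM /= -!nrmE normrZ norm_conjC mulrA.
by rewrite lecR rdot_le.
Qed.

Lemma rdot_abs_le x y : `|rdot x y| <= nrm x * nrm y.
Proof. by rewrite ler_norml rdot_le lerNl -rdotNl -(nrmN x) rdot_le. Qed.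

Lemma Re_mul_imag (z : R[i]) : complex.Re ('i%C * z) = - complex.Im z.
Proof. by rewrite mulrC ReiNIm. Qed.

Lemma rdot_imag x y : rdot ('i%C *: x) y = - rdot x ('i%C *: y).
Proof.
have ImC : complex.Im (dot y x) = - complex.Im (dot x y).
  apply: complexI; rewrite rmorphN /= !complexIm hermC expr0 mul1r.
  exact: Im_conj.
by rewrite [in RHS]rdotC /rdot !dotZl !Re_mul_imag ImC opprK.
Qed.

(** For a complex linear [T], the imaginary part of [dot (T x) y] is, up to the
    sign, the real part of [dot (T (i x)) y]. *)
Lemma rdot_adjoint (T T' : H -> H) : linear T ->
  (forall x y, rdot (T x) y = rdot x (T' y)) -> adjoint_of dot T T'.
Proof.
move=> linT TT' x y.
have TZ (a : R[i]) z : T (a *: z) = a *: T z.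
  have T0 : T 0 = 0 by have := linT (-1) 0 0; rewrite !scaleN1r !addNr.
  by have := linT a z 0; rewrite T0 !addr0.
apply/eqP; rewrite eq_complex; apply/andP; split; apply/eqP; first exact: TT'.
by apply: oppr_inj; rewrite -!Re_mul_imag -!dotZl -TZ; exact: TT'.
Qed.

Lemma adjoint_rdot (T T' : H -> H) x y :
  adjoint_of dot T T' -> rdot (T x) y = rdot x (T' y).
Proof. by move=> TT'; rewrite /rdot TT'. Qed.

Lemma cvg_nrm (u : nat -> H) l : u n @[n --> \oo] --> l <->
  forall e : R, 0 < e -> \forall n \near \oo, nrm (l - u n) < e.
Proof.
split=> [/cvgrPdist_lt ul e e0 | ul].
  have := ul e%:C; rewrite ltcR => /(_ e0); apply: filterS => n.
  by rewrite nrmE ltcR.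
apply/cvgrPdist_lt => e e0.
have eE : (complex.Re e)%:C = e by rewrite RRe_real // gtr0_real.
have := ul (complex.Re e); rewrite -ltcR eE => /(_ e0); apply: filterS => n.
by rewrite -ltcR -nrmE eE.
Qed.

Lemma cauchy_nrm (u : nat -> H) :
  (forall e : R, 0 < e ->
    exists N, forall m n, (N <= m)%N -> (N <= n)%N -> nrm (u m - u n) < e) ->
  cvg (u n @[n --> \oo]).
Proof.
move=> cu; apply: cauchy_cvg; apply/cauchyP => e e0.
have eE : (complex.Re e)%:C = e by rewrite RRe_real // gtr0_real.
have [|N hN] := cu (complex.Re e); first by rewrite -ltcR eE.
exists (u N); exists N => // n /= Nn.
by rewrite -ball_normE /ball_ /= nrmE -eE ltcR; exact: hN.
Qed.

Lemma nrm_cvg_unique (u : nat -> H) (l l' : H) :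
  u n @[n --> \oo] --> l -> u n @[n --> \oo] --> l' -> l = l'.
Proof. by move=> ul ul'; exact: (cvg_unique _ ul ul'). Qed.

Lemma rdot_cvg (u : nat -> H) l y : u n @[n --> \oo] --> l ->
  rdot (u n) y @[n --> \oo] --> rdot l y.
Proof.
move=> /cvg_nrm ul; apply/cvgrPdist_lt => e e0.
have y1 : 0 < nrm y + 1 by rewrite ltr_wpDl ?nrm_ge0.
have := ul (e / (nrm y + 1)); rewrite divr_gt0 // => /(_ isT).
apply: filterS => n h.
rewrite -rdotNl -rdotDl (le_lt_trans (rdot_abs_le _ _)) //.
rewrite ltr_pdivlMr // in h; apply: le_lt_trans h.
by rewrite ler_wpM2l ?nrm_ge0 // lerDl.
Qed.

Lemma near_all_seq (I : eqType) (s : seq I) (P : I -> nat -> Prop) :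
  (forall i, \forall n \near \oo, P i n) ->
  \forall n \near \oo, forall i, i \in s -> P i n.
Proof.
move=> hP; elim: s => [|i s IH]; first by near=> n => i; rewrite in_nil.
near=> n => j; rewrite in_cons => /orP[/eqP ->|]; first by near: n; exact: hP.
by move: j; near: n.
Unshelve. all: by end_near. Qed.

(** * Strong limits of contractions *)
Section StrongLimit.
Variables (T_ : nat -> H -> H) (T : H -> H).
Hypothesis T_lim : forall x, T_ n x @[n --> \oo] --> T x.

Lemma lim_linear : (forall n, linear (T_ n)) -> linear T.
Proof.
move=> lT a x y; apply: (nrm_cvg_unique (@T_lim _)).
under eq_fun do rewrite lT.
by apply: cvgD; [exact: cvgZr|].
Qed.

Hypothesis T_contr : forall n x, nrm (T_ n x) <= nrm x.

Lemma lim_contraction x : nrm (T x) <= nrm x.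
Proof.
apply/ler_addgt0Pr => e e0.
have /cvg_nrm /(_ e e0) /filter_ex [n h] := @T_lim x.
rewrite -(subrK (T_ n x) (T x)) (le_trans (nrmD _ _)) // addrC lerD //.
exact: ltW.
Qed.

Lemma lim_comp (u : nat -> H) l : (forall n, linear (T_ n)) ->
  u n @[n --> \oo] --> l -> T_ n (u n) @[n --> \oo] --> T l.
Proof.
move=> lT ul.
have -> : (fun n => T_ n (u n)) = (fun n => T_ n l + T_ n (u n - l)).
  apply/funext => n; have := lT n 1 l (u n - l); rewrite !scale1r => <-.
  by rewrite addrC subrK.
rewrite -[T l]addr0; apply: cvgD => //.
apply/cvg_nrm => e e0; have /cvg_nrm /(_ e e0) := ul; apply: filterS => n h.
rewrite sub0r nrmN (le_lt_trans (T_contr _ _)) //.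
by rewrite -nrmN opprB.
Qed.

Lemma lim_selfadjoint : (forall n, linear (T_ n)) ->
  (forall n, adjoint_of dot (T_ n) (T_ n)) -> adjoint_of dot T T.
Proof.
move=> lT saT; apply: rdot_adjoint => [|x y]; first exact: lim_linear.
have h := @rdot_cvg _ _ y (@T_lim x); have h' := @rdot_cvg _ _ x (@T_lim y).
have E : (fun n => rdot (T_ n x) y) = (fun n => rdot (T_ n y) x).
  by apply/funext => n; rewrite (adjoint_rdot _ _ (saT _)) rdotC.
by rewrite E in h; rewrite (rdotC x); exact: (cvg_unique _ h h').
Qed.

(** A strong limit is a weak limit, since [dot_le] bounds each of the finitely
    many entries that define a weak neighbourhood. *)
Lemma vna_lim (M : set (H -> H)) : von_neumann_algebra dot M ->
  (forall n, M (T_ n)) -> M T.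
Proof.
move=> V MT; have lT n : linear (T_ n) by have [] := vna_bounded V (MT n).
apply: (vna_closed V); split.
  split; first exact: lim_linear.
  by exists 1 => x; rewrite mul1r !nrmE lecR lim_contraction.
move=> s e e0.
have /filter_ex[n hn] : \forall n \near \oo, forall p, p \in s ->
    `|dot (T p.1 - T_ n p.1) p.2| < e%:C.
  apply: near_all_seq => -[x y] /=.
  have y1 : 0 < nrm y + 1 by rewrite ltr_wpDl ?nrm_ge0.
  have /cvg_nrm /(_ (e / (nrm y + 1))) := @T_lim x.
  rewrite divr_gt0 // => /(_ isT); apply: filterS => n h.
  apply: le_lt_trans (dot_le _ _) _; rewrite ltcR.
  rewrite ltr_pdivlMr // in h; apply: le_lt_trans h.
  by rewrite ler_wpM2l ?nrm_ge0 // lerDl.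
by exists (T_ n).
Qed.

End StrongLimit.
End Hilbert.

(** * Operators of a von Neumann algebra *)
Section VonNeumann.
Variables (R : realType) (H : completeNormedModType R[i]).
Variables (dot : {dot H for Num.conj}).
Hypothesis dot_norm : induces_norm dot.
Variable M : set (H -> H).
Hypothesis M_vna : von_neumann_algebra dot M.

Local Notation selfadjoint T := (adjoint_of dot T T).
Local Notation contraction T := (forall x, nrm (T x) <= nrm x).
Local Notation rdot := (rdot dot).

Section Operator.
Variable T : H -> H.
Hypothesis MT : M T.

Lemma vna_linear : linear T.
Proof. by have [] := vna_bounded M_vna MT. Qed.

Lemma opD x y : T (x + y) = T x + T y.
Proof. by have := vna_linear 1 x y; rewrite !scale1r. Qed.

Lemma op0 : T 0 = 0.
Proof. by apply: (addrI (T 0)); rewrite -opD !addr0. Qed.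

Lemma opZ a x : T (a *: x) = a *: T x.
Proof. by have := vna_linear a x 0; rewrite op0 !addr0. Qed.

Lemma opN x : T (- x) = - T x.
Proof. by rewrite -scaleN1r opZ scaleN1r. Qed.

Lemma opB x y : T (x - y) = T x - T y.
Proof. by rewrite opD opN. Qed.

Lemma op_bound : exists2 c : R, 0 < c & forall x, nrm (T x) <= c * nrm x.
Proof.
have [_ [c cT]] := vna_bounded M_vna MT.
exists (`|c| + 1); first by rewrite ltr_wpDl.
move=> x; have := cT x; rewrite !nrmE -rmorphM lecR => /le_trans; apply.
by rewrite ler_wpM2r ?nrm_ge0 // (le_trans (ler_norm c)) // lerDl.
Qed.

Lemma op_cvg (u : nat -> H) (l : H) : u n @[n --> \oo] --> l ->
  T (u n) @[n --> \oo] --> T l.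
Proof.
move=> /cvg_nrm ul; have [c c0 cT] := op_bound.
apply/cvg_nrm => e e0; have := ul (e / c); rewrite divr_gt0 // => /(_ isT).
apply: filterS => n; rewrite ltr_pdivlMr // mulrC -opB.
exact: le_lt_trans.
Qed.

End Operator.

Lemma vna_sub T S : M T -> M S -> M (fun x => T x - S x).
Proof.
move=> MT MS; have -> : (fun x => T x - S x) = T + ((-1) *: S).
  by apply/funext => x; rewrite -scaleN1r.
by apply: (vna_add M_vna) => //; exact: (vna_scale M_vna).
Qed.

(** * Projections on kernels *)
Section ContractionKernel.
Variable A : H -> H.
Hypotheses (MA : M A) (saA : selfadjoint A) (ctA : contraction A).

Definition one_sub_sqr x := x - A (A x).
Local Notation G := one_sub_sqr.

Lemma one_sub_sqr_vna : M G.
Proof. exact: (vna_sub (vna_id M_vna) (vna_comp M_vna MA MA)). Qed.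

Lemma one_sub_sqr_rdot x y : rdot (G x) y = rdot x (G y).
Proof.
rewrite !rdotDl !rdotDr !rdotNl !rdotNr.
by rewrite !(adjoint_rdot _ _ saA).
Qed.

(** This makes [G] a contraction, and strictly decreases the norm outside the
    kernel of [A]. *)
Lemma one_sub_sqr_nrm x : nrm (G x) ^+ 2 <= nrm x ^+ 2 - nrm (A x) ^+ 2.
Proof.
rewrite (nrmB_sqr dot_norm) -(adjoint_rdot _ _ saA) -(nrm_sqr dot_norm).
have : nrm (A (A x)) ^+ 2 <= nrm (A x) ^+ 2.
  by rewrite ler_sqr ?nnegrE ?nrm_ge0.
lra.
Qed.

Lemma one_sub_sqr_contraction : contraction G.
Proof.
move=> x; rewrite -ler_sqr ?nnegrE ?nrm_ge0 //.
by apply: le_trans (one_sub_sqr_nrm x) _; rewrite gerBl sqr_ge0.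
Qed.

Let P n := iter n G.

Let P_vna n : M (P n).
Proof.
elim: n => [|n IH]; first exact: (vna_id M_vna).
exact: (vna_comp M_vna one_sub_sqr_vna IH).
Qed.

Let P_rdot n m x y : rdot (P n x) (P m y) = rdot (P (m + n) x) y.
Proof.
elim: m n y => [|m IH] n y //=.
by rewrite -one_sub_sqr_rdot -[G (P n x)]/(P n.+1 x) IH addnS.
Qed.

(** [|P n x|^2] decreases, hence converges; since [G] is selfadjoint, the inner
    products of even powers are also terms of this sequence:
    [|P 2m x - P 2n x|^2 = a 2m - 2 a (m + n) + a 2n]. *)
Let P_cauchy x : cvg (P n.*2 x @[n --> \oo]).
Proof.
pose a n := nrm (P n x) ^+ 2.
have a_cvg : cvg (a n @[n --> \oo]).
  apply: nonincreasing_is_cvgn.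
    apply/nonincreasing_seqP => n.
    by rewrite /a ler_sqr ?nnegrE ?nrm_ge0 //; exact: one_sub_sqr_contraction.
  by exists 0 => _ [n _ <-]; exact: sqr_ge0.
apply: cauchy_nrm => e e0.
have := a_cvg => /cvgrPdist_lt /(_ (e ^+ 2 / 4)).
rewrite divr_gt0 ?exprn_gt0 // => /(_ isT) [N _ hN].
exists N => m n Nm Nn.
rewrite -ltr_sqr ?nnegrE ?nrm_ge0 ?(ltW e0) // (nrmB_sqr dot_norm).
have -> : rdot (P m.*2 x) (P n.*2 x) = a (m + n)%N.
  rewrite /a (nrm_sqr dot_norm) !P_rdot; congr (rdot (P _ x) x).
  by rewrite -!addnn addnACA addnC.
have Nd k : (N <= k)%N -> (N <= k.*2)%N.
  by move=> /leq_trans; apply; rewrite -addnn leq_addr.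
have := hN _ (Nd _ Nm); have := hN _ (Nd _ Nn).
have := hN (m + n)%N (leq_trans Nm (leq_addr _ _)).
rewrite /= -![nrm (P _ x) ^+ 2]/(a _) !ltr_distl.
move=> /andP[? ?] /andP[? ?] /andP[? ?]; lra.
Qed.

(** The projection is the strong limit of the even powers of [G].  A vector
    [y = E x] is fixed by [G^2], so that [G] preserves its norm, which
    [one_sub_sqr_nrm] permits only if [A y = 0]. *)
Lemma kernel_projection_contraction : exists E, [/\ M E, projection dot E &
  forall x, A x = 0 <-> E x = x].
Proof.
pose E x : H := lim (P n.*2 x @[n --> \oo]).
have E_lim x : P n.*2 x @[n --> \oo] --> E x by exact: P_cauchy.
have P_contr n x : nrm (P n x) <= nrm x.
  elim: n => [|n IH] //=; exact: le_trans (one_sub_sqr_contraction _) IH.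
have P_lin n : linear (P n) by exact: vna_linear.
have ME : M E by apply: (vna_lim dot_norm E_lim) => // n; exact: P_vna.
have saE : selfadjoint E.
  apply: (lim_selfadjoint dot_norm E_lim) => [n|n]; first exact: P_lin.
  apply: rdot_adjoint => // x y.
  by have := P_rdot 0 n.*2 x y; rewrite addn0 => <-.
have EA x : A x = 0 -> E x = x.
  move=> Ax; have Gx : G x = x by rewrite /one_sub_sqr Ax op0 ?subr0.
  apply: (nrm_cvg_unique (@E_lim x)).
  have -> : (fun n => P n.*2 x) = fun=> x.
    by apply/funext => n; elim: n.*2 => //= k ->.
  exact: cvg_cst.
have AE x : A (E x) = 0.
  have GGE : G (G (E x)) = E x.
    have MG := one_sub_sqr_vna.
    have h := op_cvg (vna_comp M_vna MG MG) (@E_lim x).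
    have := @E_lim x; rewrite -(cvg_shiftS (fun n => P n.*2 x)).
    exact: nrm_cvg_unique h.
  have h1 := one_sub_sqr_nrm (E x); have h2 := one_sub_sqr_nrm (G (E x)).
  rewrite GGE in h2; apply: nrm_eq0; apply/eqP.
  rewrite -sqrf_eq0 eq_le sqr_ge0 andbT.
  have := sqr_ge0 (nrm (A (G (E x)))); lra.
exists E; split=> // [|x]; last by split=> [/EA|<-].
by split=> //; apply/funext => x /=; exact: EA.
Qed.

End ContractionKernel.

Lemma vna_scaler (t : R) T : M T -> M (fun x => t%:C *: T x).
Proof. exact: (vna_scale M_vna). Qed.

(** [A] has the same kernel as the positive operator [A^* A], which becomes a
    selfadjoint contraction after scaling. *)
Lemma kernel_projection A : M A ->
  exists E, [/\ M E, projection dot E & forall x, A x = 0 <-> E x = x].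
Proof.
move=> MA; have [A' MA' AA'] := vna_adjoint M_vna MA.
have MB := vna_comp M_vna MA' MA; have [c c0 cB] := op_bound MB.
pose B x := c^-1%:C *: A' (A x).
have [|x y|x|E [ME pE EB]] := @kernel_projection_contraction B.
- exact: vna_scaler.
- apply: rdot_adjoint x y => [|x y].
    by apply: vna_linear; exact: vna_scaler.
  rewrite /B rdotZl rdotZr -(adjoint_rdot _ _ AA') (rdotC _ (A' _)).
  by rewrite -(adjoint_rdot _ _ AA') rdotC.
- by rewrite nrmZ gtr0_norm ?invr_gt0 // ler_pdivrMl //; exact: cB.
exists E; split=> // x; rewrite -EB /B; split=> [->|].
  by rewrite (op0 MA') scaler0.
move/eqP; rewrite scaler_eq0 => /orP[/eqP/complexI /eqP|/eqP A'A0].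
  by rewrite invr_eq0 gt_eqF.
apply: nrm_eq0; apply/eqP; rewrite -sqrf_eq0 (nrm_sqr dot_norm).
by rewrite (adjoint_rdot _ _ AA') A'A0 rdot0r.
Qed.

(** * Square roots *)
Section SquareRoot.
Variable X : H -> H.
Hypotheses (MX : M X) (ctX : contraction X).

(** The scheme [Y -> (X + Y^2) / 2], whose fixed points satisfy
    [(1 - Y)^2 = 1 - X]. *)
Fixpoint sqrt_iter n : H -> H :=
  if n is n'.+1 then fun x => 2^-1%:C *: (X x + sqrt_iter n' (sqrt_iter n' x))
  else fun=> 0.
(** The same scheme for the number [X = 1]: it increases to [1] and dominates the
    norms of the iterates and of their differences. *)
Fixpoint sqrt_bound n : R :=
  if n is n'.+1 then (1 + sqrt_bound n' ^+ 2) / 2 else 0.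
Local Notation Y := sqrt_iter.
Local Notation y := sqrt_bound.

Let Y_vna n : M (Y n).
Proof.
elim: n => [|n MY].
  have -> : Y 0 = (fun x => x - x) by apply/funext => x; rewrite subrr.
  exact: (vna_sub (vna_id M_vna) (vna_id M_vna)).
by apply: vna_scaler; apply: (vna_add M_vna) => //; exact: (vna_comp M_vna).
Qed.

Let y_ge0 n : 0 <= y n.
Proof. by elim: n => //= n _; rewrite divr_ge0 // addr_ge0 // sqr_ge0. Qed.

Let y_le1 n : y n <= 1.
Proof. by elim: n => //= n IH; have := y_ge0 n; nra. Qed.

Let y_incr n : y n <= y n.+1.
Proof. by have /= := sqr_ge0 (y n - 1); nra. Qed.

Let Y_bound n x : nrm (Y n x) <= y n * nrm x.
Proof.
elim: n x => [|n IH] x /=; first by rewrite mul0r nrm0.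
rewrite nrmZ ger0_norm ?invr_ge0 //.
have := nrmD (X x) (Y n (Y n x)); have := ctX x; have := IH x.
have := IH (Y n x); have := y_ge0 n; nra.
Qed.

(** Writing [Y'] for the iterate after [Y], the next difference is half of
    [Y'^2 - Y^2 = Y' (Y' - Y) + (Y' - Y) Y], and the bounds obey the same
    identity. *)
Let Y_step n x : nrm (Y n.+1 x - Y n x) <= (y n.+1 - y n) * nrm x.
Proof.
elim: n x => [|n IH] x; first by rewrite subr0 [y 0]/= subr0; exact: Y_bound.
have -> : Y n.+2 x - Y n.+1 x = 2^-1%:C *:
    (Y n.+1 (Y n.+1 x - Y n x) + (Y n.+1 (Y n x) - Y n (Y n x))).
  rewrite (opB (Y_vna n.+1)) addrA subrK.
  rewrite [LHS]/= -scalerBr; congr (_ *: _).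
  by rewrite opprD addrACA subrr add0r.
rewrite nrmZ ger0_norm ?invr_ge0 //.
have h1 := nrmD (Y n.+1 (Y n.+1 x - Y n x)) (Y n.+1 (Y n x) - Y n (Y n x)).
have h2 := Y_bound n.+1 (Y n.+1 x - Y n x).
have h3 := IH (Y n x); have h4 := IH x; have h5 := Y_bound n x.
have h6 := y_ge0 n; have h7 := y_ge0 n.+1; have h8 := y_incr n.
have h9 : y n.+1 * nrm (Y n.+1 x - Y n x) <= y n.+1 * ((y n.+1 - y n) * nrm x).
  exact: ler_wpM2l.
have h10 : (y n.+1 - y n) * nrm (Y n x) <= (y n.+1 - y n) * (y n * nrm x).
  by rewrite ler_wpM2l // subr_ge0.
have -> : y n.+2 - y n.+1 = (y n.+1 + y n) * (y n.+1 - y n) / 2.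
  have e1 : y n.+2 = (1 + y n.+1 ^+ 2) / 2 by [].
  have e2 : y n.+1 = (1 + y n ^+ 2) / 2 by [].
  by rewrite e1; move: (y n) (y n.+1) e2 => p q ?; lra.
lra.
Qed.

Let Y_dist n k x : nrm (Y (n + k) x - Y n x) <= (y (n + k)%N - y n) * nrm x.
Proof.
elim: k => [|k IH]; first by rewrite addn0 !subrr mul0r nrm0.
rewrite addnS -(subrK (Y (n + k) x) (Y _.+1 x)) -addrA.
apply: le_trans (nrmD _ _) _.
have := Y_step (n + k) x; lra.
Qed.

Let Y_cvg x : cvg (Y n x @[n --> \oo]).
Proof.
have y_mono : {homo y : m n / (m <= n)%N >-> m <= n} by exact/nondecreasing_seqP.
have y_cvg : cvg (y n @[n --> \oo]).
  by apply: nondecreasing_is_cvgn => //; exists 1 => _ [n _ <-].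
apply: cauchy_nrm => e e0.
have x1 : 0 < nrm x + 1 by rewrite ltr_wpDl ?nrm_ge0.
have := y_cvg => /cvgrPdist_lt /(_ (e / (2 * (nrm x + 1)))).
rewrite divr_gt0 ?mulr_gt0 // => /(_ isT) [N _ hN].
exists N.
suff W m n : (N <= m)%N -> (m <= n)%N -> nrm (Y n x - Y m x) < e.
  move=> m n Nm Nn; have [mn|/ltnW nm] := leqP m n; last exact: W.
  by rewrite -nrmN opprB; exact: W.
move=> Nm mn; have := Y_dist m (n - m) x.
rewrite subnKC // => /le_lt_trans; apply.
have := hN _ Nm; have := hN _ (leq_trans Nm mn); rewrite /= !ltr_distl.
rewrite invfM mulrA => /andP[? ?] /andP[? ?].
have h : y n - y m < e / (nrm x + 1) by lra.
rewrite ltr_pdivlMr // in h; apply: le_lt_trans h.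
by rewrite ler_wpM2l ?lerDl // subr_ge0; exact: y_mono.
Qed.

(** The third clause is the equation [(1 - Y)^2 = 1 - X], expanded. *)
Lemma sqrt_one_sub : exists Y, [/\ M Y, contraction Y,
  forall x, Y x + Y x = X x + Y (Y x),
  selfadjoint X -> selfadjoint Y &
  forall B, M B -> (forall x, B (X x) = X (B x)) ->
    forall x, B (Y x) = Y (B x)].
Proof.
pose Z x : H := lim (Y n x @[n --> \oo]).
have Z_lim x : Y n x @[n --> \oo] --> Z x by exact: Y_cvg.
have Y_contr n x : nrm (Y n x) <= nrm x.
  by apply: le_trans (Y_bound n x) _; rewrite ler_piMl // nrm_ge0.
have Y_lin n : linear (Y n) by exact: vna_linear.
exists Z; split=> [||x|saX|B MB BX x].
- exact: (vna_lim dot_norm Z_lim).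
- exact: (lim_contraction Z_lim Y_contr).
- have h : X x + Y n (Y n x) @[n --> \oo] --> X x + Z (Z x).
    by apply: cvgD; [exact: cvg_cst|exact: (lim_comp Z_lim)].
  apply: nrm_cvg_unique h.
  have := @Z_lim x; rewrite -(cvg_shiftS (fun n => Y n x)) => hS.
  have -> : (fun n => X x + Y n (Y n x)) = (fun n => Y n.+1 x + Y n.+1 x).
    apply/funext => n /=; rewrite -scalerDl -rmorphD /=.
    by rewrite (_ : 2^-1 + 2^-1 = 1 :> R) ?scale1r //; lra.
  exact: cvgD.
- apply: (lim_selfadjoint dot_norm Z_lim) => //.
  elim=> [|n IH]; first by move=> u v; rewrite linear0l linear0r.
  apply: rdot_adjoint => // u v.
  rewrite !(rdotZl, rdotZr) !(rdotDl, rdotDr) (adjoint_rdot _ _ saX).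
  by rewrite !(adjoint_rdot _ _ IH).
have BY n u : B (Y n u) = Y n (B u).
  elim: n u => [|n IH] u; first exact: op0.
  by rewrite /= (opZ MB) (opD MB) BX !IH.
have h := op_cvg MB (@Z_lim x).
apply: (nrm_cvg_unique h).
have -> : (fun n => B (Y n x)) = (fun n => Y n (B x)) by exact/funext.
exact: Z_lim.
Qed.

End SquareRoot.

(** * Elements commuting with all projections *)

(** Real linear identities between vectors are checked after pairing with an
    arbitrary vector. *)
Ltac vector_lra :=
  apply: (rdot_ext dot_norm) => ?; rewrite !(rdotDl, rdotNl, rdotZl); lra.

Lemma nrm_reflection E x : M E -> projection dot E ->
  nrm (E x + E x - x) = nrm x.
Proof.
move=> ME [EE saE].
have e : rdot (E x) (E x) = rdot (E x) x.
  by rewrite -[in LHS](adjoint_rdot _ _ saE) -[E (E x)]/((E \o E) x) EE.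
apply/eqP; rewrite -(@eqrXn2 _ 2) ?nrm_ge0 //; apply/eqP.
rewrite !(nrm_sqr dot_norm) !(rdotDl, rdotDr, rdotNl, rdotNr).
by rewrite (rdotC _ x) !e; lra.
Qed.

(** Here [S^2 = A^2], so that [(S - A) (S + A) = 0] and the projection [E] on the
    kernel of [S - A] fixes the range of [S + A].  Taking adjoints,
    [(S + A) E = S + A], while [S E = A E]; thus [A = S (2 E - 1)].  With
    [u = (2 E - 1) x], of the same norm as [x], the parallelogram identity turns
    [|S u| <= |u|] and [|u - S u| <= |u|] into
    [|S u - u / 2|^2 <= 3 / 4 |u|^2]. *)
Lemma projection_halving A : M A -> selfadjoint A -> contraction A ->
  exists E, [/\ M E, projection dot E &
    forall x, nrm (A x - E x + 2^-1%:C *: x) ^+ 2 <= 3 / 4 * nrm x ^+ 2].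
Proof.
move=> MA saA ctA.
have [Y [MY ctY YY saY BY]] := sqrt_one_sub
  (one_sub_sqr_vna MA) (one_sub_sqr_contraction saA ctA).
have {}saY : selfadjoint Y.
  apply: saY; apply: rdot_adjoint => [|x y].
    exact: (vna_linear (one_sub_sqr_vna MA)).
  exact: one_sub_sqr_rdot.
pose S x := x - Y x.
have MS : M S by exact: (vna_sub (vna_id M_vna) MY).
have saS x y : rdot (S x) y = rdot x (S y).
  by rewrite /S !(rdotDl, rdotDr, rdotNl, rdotNr) (adjoint_rdot _ _ saY).
have rA x y := adjoint_rdot x y saA.
have AS x : A (S x) = S (A x).
  rewrite /S (opB MA) BY // => z.
  by rewrite /one_sub_sqr (opB MA).
have SS x : S (S x) = A (A x).
  rewrite /S (opB MY).
  have -> : A (A x) = x - (Y x + Y x) + Y (Y x).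
    by rewrite YY /one_sub_sqr; vector_lra.
  by vector_lra.
have [E [ME pE EK]] := kernel_projection (vna_sub MS MA).
have E1 x : E (S x + A x) = S x + A x.
  by apply/EK; rewrite (opD MS) (opD MA) SS AS [A (A x) + _]addrC subrr.
have E2 x : S (E x) + A (E x) = S x + A x.
  apply: (rdot_ext dot_norm) => z; have [_ saE] := pE.
  rewrite rdotDl saS rA -rdotDr (adjoint_rdot _ _ saE) E1.
  by rewrite rdotDl rdotDr saS rA.
have E3 x : S (E x) = A (E x).
  apply/eqP; rewrite -subr_eq0; apply/eqP/EK.
  by case: pE => EE _; rewrite -[E (E x)]/((E \o E) x) EE.
exists E; split=> // x.
pose u := E x + E x - x.
have -> : A x - E x + 2^-1%:C *: x = S u - 2^-1%:C *: u.
  have -> : A x = S (E x) + S (E x) - S x by rewrite {2}E3 E2; vector_lra.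
  by rewrite /u (opB MS) (opD MS); vector_lra.
rewrite -(nrm_reflection x ME pE) -/u; move: u => {x}u.
have Su : nrm (S u) ^+ 2 <= nrm u ^+ 2.
  rewrite (nrm_sqr dot_norm) saS SS -rA -(nrm_sqr dot_norm).
  by rewrite ler_sqr ?nnegrE ?nrm_ge0.
have uSu : nrm (u - S u) ^+ 2 <= nrm u ^+ 2.
  by rewrite /S opprB addrC subrK ler_sqr ?nnegrE ?nrm_ge0.
move: (S u) Su uSu => s su; rewrite !(nrmB_sqr dot_norm) rdotZr nrmZ.
rewrite ger0_norm ?invr_ge0 // (rdotC _ u s); lra.
Qed.

(** [A] and [A - E + 1 / 2] have the same commutator with [C], and the latter has
    norm at most [sqrt 3 / 2 < 9 / 10].  Its multiple by [10 / 9] is again a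
    selfadjoint contraction, so the argument can be repeated and gains a factor
    [9 / 10] each time. *)
Lemma commute_selfadjoint_of_projections C A : M C ->
  (forall E, M E -> projection dot E -> C \o E = E \o C) ->
  M A -> selfadjoint A -> contraction A -> C \o A = A \o C.
Proof.
move=> MC CE MA saA ctA; have [c c0 cC] := op_bound MC.
have geom n B : M B -> selfadjoint B -> contraction B ->
    forall x, nrm (C (B x) - B (C x)) <= 2 * c * nrm x * (9 / 10) ^+ n.
  elim: n B => [|n IH] B MB saB ctB x.
    have := nrmD (C (B x)) (- B (C x)); rewrite nrmN.
    have := cC (B x); have := cC x; have := ctB x; have := ctB (C x).
    by rewrite expr0 mulr1; nra.
  have [E [ME pE hE]] := projection_halving MB saB ctB.
  pose B' y := (10 / 9)%:C *: (B y - E y + 2^-1%:C *: y).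
  have MB' : M B'.
    apply: vna_scaler; apply: (vna_add M_vna).
      exact: vna_sub.
    exact: (vna_scaler _ (vna_id M_vna)).
  have saB' : selfadjoint B'.
    apply: rdot_adjoint => [|y z]; first exact: vna_linear.
    have [_ saE] := pE.
    rewrite !(rdotZl, rdotZr, rdotDl, rdotDr, rdotNl, rdotNr).
    by rewrite (adjoint_rdot _ _ saB) (adjoint_rdot _ _ saE).
  have ctB' : contraction B'.
    move=> y; rewrite /B' nrmZ ger0_norm ?divr_ge0 //.
    rewrite -ler_sqr ?nnegrE ?mulr_ge0 ?nrm_ge0 ?divr_ge0 // exprMn.
    by have := hE y; have := sqr_ge0 (nrm y); lra.
  have -> : C (B x) - B (C x) = (9 / 10)%:C *: (C (B' x) - B' (C x)).
    have CEx : C (E x) = E (C x) by have /(congr1 (@^~ x)) := CE E ME pE.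
    by rewrite /B' (opZ MC) (opD MC) (opB MC) (opZ MC) CEx; vector_lra.
  rewrite nrmZ ger0_norm ?divr_ge0 // exprS mulrCA ler_wpM2l ?divr_ge0 //.
  exact: IH.
apply/funext => x /=; apply/eqP; rewrite -subr_eq0; apply/eqP/nrm_eq0/eqP.
rewrite eq_le nrm_ge0 andbT; apply/ler_addgt0Pr => e e0; rewrite add0r.
have k0 : (fun n => 2 * c * nrm x * (9 / 10) ^+ n) @ \oo --> (0 : R).
  rewrite -[0](mulr0 (2 * c * nrm x)); apply: cvgMr; apply: cvg_expr.
  by rewrite ger0_norm ?divr_ge0 //; lra.
have /cvgrPdist_lt /(_ e e0) /filter_ex [n] := k0.
rewrite sub0r normrN => /(le_lt_trans (ler_norm _)) /ltW; apply: le_trans.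
exact: geom.
Qed.

Lemma commute_of_projections C A : M C ->
  (forall E, M E -> projection dot E -> C \o E = E \o C) ->
  M A -> C \o A = A \o C.
Proof.
move=> MC CE.
have sa B : M B -> selfadjoint B -> forall x, C (B x) = B (C x).
  move=> MB saB x; have [c c0 cB] := op_bound MB.
  have MB' := vna_scaler c^-1 MB.
  have := @commute_selfadjoint_of_projections C _ MC CE MB'.
  have hsa : selfadjoint (fun y => c^-1%:C *: B y).
    apply: rdot_adjoint => [|y z]; first exact: vna_linear.
    by rewrite rdotZl rdotZr (adjoint_rdot _ _ saB).
  have hct y : nrm (c^-1%:C *: B y) <= nrm y.
    by rewrite nrmZ gtr0_norm ?invr_gt0 // ler_pdivrMl.
  move=> /(_ hsa hct) /(congr1 (@^~ x)) /=; rewrite (opZ MC).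
  apply: scalerI; apply/negP => /eqP/complexI/eqP.
  by rewrite invr_eq0 gt_eqF.
move=> MA; have [A' MA' AA'] := vna_adjoint M_vna MA.
have A'A x y : rdot (A' x) y = rdot x (A y).
  by rewrite rdotC -(adjoint_rdot _ _ AA') rdotC.
(* Twice the real part and, up to the sign, twice the imaginary part of [A]. *)
pose Re x := A x + A' x.
pose Im x := 'i%C *: (A x - A' x).
have MRe : M Re by exact: (vna_add M_vna).
have MIm : M Im by apply: (vna_scale M_vna); exact: vna_sub.
have saRe : selfadjoint Re.
  apply: rdot_adjoint => [|x y]; first exact: vna_linear.
  by rewrite rdotDl rdotDr (adjoint_rdot _ _ AA') A'A addrC.
have saIm : selfadjoint Im.
  apply: rdot_adjoint => [|x y]; first exact: vna_linear.
  have ImE : Im y = A ('i%C *: y) - A' ('i%C *: y).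
    by rewrite (opZ MA) (opZ MA') -scalerBr.
  rewrite ImE rdot_imag rdotDl rdotNl A'A (adjoint_rdot _ _ AA').
  by rewrite rdotDr rdotNr opprB.
have AE x : A x = 2^-1%:C *: (Re x - 'i%C *: Im x).
  rewrite /Re /Im scalerA -expr2 sqr_i scaleN1r; vector_lra.
apply/funext => x /=.
by rewrite !AE (opZ MC) (opB MC) (opZ MC) (sa Re) // (sa Im).
Qed.

(** * Central elements annihilated by commutators *)

(** The kernel of a central [D] is invariant under each [T] in [M] and under its
    adjoint; hence [E T E = T E] and [E T^* E = T^* E], and the adjoint of the
    latter is [E T E = E T]. *)
Lemma central_kernel_projection D E : M D ->
  (forall T, M T -> D \o T = T \o D) -> projection dot E ->
  (forall x, D x = 0 <-> E x = x) ->
  forall T, M T -> E \o T = T \o E.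
Proof.
move=> MD DT [EE saE] EK.
have ETE T x : M T -> E (T (E x)) = T (E x).
  move=> MT; apply/EK.
  rewrite -[LHS]/((D \o T) (E x)) (DT T MT) /= ((EK (E x)).2 _) ?op0 //.
  by rewrite -[LHS]/((E \o E) x) EE.
move=> T MT; apply/funext => x /=; apply: (rdot_ext dot_norm) => z.
have [T' MT' TT'] := vna_adjoint M_vna MT.
have sE u v := adjoint_rdot u v saE; have tT u v := adjoint_rdot u v TT'.
by rewrite -[in RHS](ETE T) // !sE !tT !sE (ETE T').
Qed.

(** The ranges of all commutators lie in the kernel of [D]; so the complement [Q]
    of the central projection on this kernel cuts out a commutative summand, and
    must be zero. *)
Lemma no_I1_central_eq0 D : no_central_summand_I1 dot M ->
  M D -> (forall T, M T -> D \o T = T \o D) ->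
  (forall S T, M S -> M T -> forall x, D (S (T x)) = D (T (S x))) -> D = 0.
Proof.
move=> noI1 MD DT DST; have [E [ME [EE saE] EK]] := kernel_projection MD.
have ET := central_kernel_projection MD DT (conj EE saE) EK.
apply: contrapT => D0; apply: noI1; pose Q x := x - E x; exists Q.
have MQ : M Q by exact: (vna_sub (vna_id M_vna) ME).
have QQ : Q \o Q = Q.
  apply/funext => x /=; rewrite /Q (opB ME) -[E (E x)]/((E \o E) x) EE.
  by rewrite subrr subr0.
have QT T : M T -> Q \o T = T \o Q.
  move=> MT; apply/funext => x /=; rewrite /Q (opB MT).
  by rewrite -[E (T x)]/((E \o T) x) ET.
split.
- split=> //; split=> //; apply: rdot_adjoint => [|x y].
    exact: (vna_linear MQ).
  by rewrite /Q !(rdotDl, rdotDr, rdotNl, rdotNr) (adjoint_rdot _ _ saE).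
- move=> Q0; apply: D0; apply/funext => x; apply/EK.
  apply/eqP; rewrite -subr_eq0 -opprB oppr_eq0; apply/eqP.
  by rewrite -[LHS]/(Q x) Q0.
move=> _ _ [S MS <-] [T MT <-]; apply/funext => x.
have QSQT U V y : M U -> M V -> Q (U (Q (V y))) = Q (U (V y)).
  move=> MU MV; rewrite -[U (Q _)]/((U \o Q) (V y)) -QT //=.
  by rewrite -[LHS]/((Q \o Q) (U (V y))) QQ.
rewrite -[LHS]/(Q (S (Q (T x)))) -[RHS]/(Q (T (Q (S x)))).
rewrite (QSQT S T) // (QSQT T S) //.
apply/eqP; rewrite -subr_eq0 -(opB MQ) /Q; apply/eqP.
suff -> : E (S (T x) - T (S x)) = S (T x) - T (S x) by rewrite subrr.
by apply/EK; rewrite (opB MD) (DST S T) // subrr.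
Qed.

End VonNeumann.

(** * A von Neumann algebra as a ring *)

(** The maps of [H] into itself do not form a ring, since [f \o (g + h)] need not
    be [f \o g + f \o h]; the elements of [M] do, because they are linear. *)
Section OperatorRing.
Variables (R : realType) (H : completeNormedModType R[i]).
Variables (dot : {dot H for Num.conj}) (M : set (H -> H)).

Definition vna_ring of von_neumann_algebra dot M := {T : H -> H | M T}.

Variable M_vna : von_neumann_algebra dot M.
Local Notation A := (vna_ring M_vna).

HB.instance Definition _ := gen_eqMixin A.
HB.instance Definition _ := gen_choiceMixin A.

Lemma vna_ext (x y : A) : sval x =1 sval y -> x = y.
Proof.
case: x y => [S MS] [T MT] /funext /= ST; rewrite {S}ST in MS *.
by congr exist; exact: Prop_irrelevance.
Qed.

Lemma vna_opp T : M T -> M (- T).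
Proof. by move=> MT; rewrite -scaleN1r; exact: (vna_scale M_vna). Qed.

Lemma vna_zero : M 0.
Proof.
by rewrite -(scale0r idfun); exact: (vna_scale M_vna 0 (vna_id M_vna)).
Qed.

Definition vr_zero : A := exist _ _ vna_zero.
Definition vr_one : A := exist _ _ (vna_id M_vna).
Definition vr_add (x y : A) : A :=
  exist _ _ (vna_add M_vna (svalP x) (svalP y)).
Definition vr_opp (x : A) : A := exist _ _ (vna_opp (svalP x)).
Definition vr_mul (x y : A) : A :=
  exist _ _ (vna_comp M_vna (svalP x) (svalP y)).

Fact vr_addA : associative vr_add.
Proof. by move=> x y z; apply: vna_ext => t; exact: addrA. Qed.
Fact vr_addC : commutative vr_add.
Proof. by move=> x y; apply: vna_ext => t; exact: addrC. Qed.
Fact vr_add0 : left_id vr_zero vr_add.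
Proof. by move=> x; apply: vna_ext => t; exact: add0r. Qed.
Fact vr_addN : left_inverse vr_zero vr_opp vr_add.
Proof. by move=> x; apply: vna_ext => t; exact: addNr. Qed.
Fact vr_mulA : associative vr_mul.
Proof. by move=> x y z; apply: vna_ext. Qed.
Fact vr_mul1 : left_id vr_one vr_mul.
Proof. by move=> x; apply: vna_ext. Qed.
Fact vr_1mul : right_id vr_one vr_mul.
Proof. by move=> x; apply: vna_ext. Qed.
Fact vr_mulDl : left_distributive vr_mul vr_add.
Proof. by move=> x y z; apply: vna_ext. Qed.
Fact vr_mulDr : right_distributive vr_mul vr_add.
Proof.
by move=> x y z; apply: vna_ext => t; exact: (opD M_vna (svalP x)).
Qed.

HB.instance Definition _ := GRing.isZmodule.Build A
  vr_addA vr_addC vr_add0 vr_addN.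
HB.instance Definition _ := GRing.Zmodule_isPzRing.Build A
  vr_mulA vr_mul1 vr_1mul vr_mulDl vr_mulDr.

End OperatorRing.

Unset Implicit Arguments.

Theorem theorem1p1 (R : realType) (H : completeNormedModType R[i])
    (dot : {dot H for Num.conj}) (dot_norm : induces_norm dot)
    (M : set (H -> H)) (M_vna : von_neumann_algebra dot M)
    (M_no_I1 : no_central_summand_I1 dot M)
    (Phi : {fun M >-> M}) (Phi_der : nonlinear_derivation Phi) :
  additive_derivation Phi.
Proof.
split=> [T S MT MS|]; last exact: Phi_der.
pose A := vna_ring M_vna.
pose phi (x : A) : A := exist _ (Phi (sval x)) (funS _ (svalP x)).
have phiM x y : phi (x * y) = phi x * y + x * phi y.
  apply: vna_ext => t.
  by have /(congr1 (@^~ t)) := Phi_der _ _ (svalP x) (svalP y).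
pose D x y := sval (defect phi x y).
have central x y (a : A) : a * defect phi x y = defect phi x y * a.
  apply: vna_ext => t.
  have DE E : M E -> projection dot E -> D x y \o E = E \o D x y.
    move=> ME [EE _]; pose e : A := exist _ E ME.
    have ee : e * e = e.
      by apply: vna_ext => u; rewrite /= -[LHS]/((E \o E) u) EE.
    by have /(congr1 sval) /= := defect_comm_idempotent phiM x y ee.
  have := commute_of_projections dot_norm M_vna (svalP _) DE (svalP a).
  by move=> /(congr1 (@^~ t)).
pose x : A := exist _ T MT; pose y : A := exist _ S MS.
have D0 : D x y = 0.
  apply: (no_I1_central_eq0 dot_norm M_vna M_no_I1) => [|U MU|U V MU MV t].
  - exact: svalP.
  - by have /(congr1 sval) /= := central x y (exist _ U MU).
  pose a : A := exist _ U MU; pose b : A := exist _ V MV.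
  (* [d (a b) = a (b d)], where [b d] is again a defect, hence central. *)
  have abD : defect phi x y * (a * b) = defect phi x y * (b * a).
    rewrite -!central -mulrA [b * defect _ _ _](defectMl phiM) central.
    by rewrite -(defectMl phiM) -mulrA -central mulrA.
  by have /(congr1 (fun z : A => sval z t)) := abD.
have /(congr1 sval) : phi (x + y) = phi x + phi y.
  by apply: defect_eq0; apply: vna_ext => t; rewrite -[LHS]/(D x y t) D0.
by [].
Qed.
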